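(* One has $$\lim_{\mu\downarrow0}\big(x(\mu),z(\mu),s(\mu),u(\mu)\big)=(\overline{x},\overline{z},\overline{s},\overline{u}).$$ Moreover, $(\overline{x},\overline{z})$ and $(\overline{x},\overline{s},\overline{u})$ belong to the relative interior of $S_{(P)}$ and of $S_{(D)}$, respectively.
   Context: Let $n,p,q$ be positive integers, $y\in\mathbb{R}^q$, $\lambda>0$, $\Phi:\mathbb{R}^n\to\mathbb{R}^q$ linear, and $D:\mathbb{R}^p\to\mathbb{R}^n$ linear with adjoint $D^*$. Standing assumption: $\operatorname{Ker} D^*\cap\operatorname{Ker}\Phi=\{0\}$. Set $Q=\Phi^*\Phi$, $c=\Phi^*y$, $\tilde I=(I_p\ \ {-I_p})$ (a $p\times 2p$ matrix), $e=(1,\dots,1)\in\mathbb{R}^{2p}$. Primal problem $(P)$: minimize $f(x,z)$ over $x\in\mathbb{R}^n$, $z\in[0,+\infty)^{2p}$, where $f(x,z)=\frac12\langle Qx,x\rangle-\langle c,x\rangle+\lambda\langle e,z\rangle$ if $D^*x+\tilde I z=0$ and $f(x,z)=+\infty$ otherwise. Dual problem $(D)$: maximize $g(x,s,u)$ over $x\in\mathbb{R}^n$, $s\in[0,+\infty)^{2p}$, $u\in\mathbb{R}^p$, where $g(x,s,u)=-\frac12\langle Qx,x\rangle$ if $Du+c-Qx=0$ and $s=\lambda e-\tilde I^*u$, and $g=-\infty$ otherwise. $S_{(P)}$ (set of pairs $(x,z)$) and $S_{(D)}$ (set of triples $(x,s,u)$) denote the sets of optimal solutions of $(P)$ and $(D)$;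 both are nonempty and the two optimal values coincide, with common value $\alpha$. Barrier path: for $\mu>0$, let $F_\mu(x,z)=f(x,z)+\mu\,\xi(z/\mu)$, where $\xi(z)=-\ln\big(\prod_{i=1}^{2p}z_i\big)^{1/(2p)}$ if all $z_i>0$ and $\xi(z)=+\infty$ otherwise. $F_\mu$ has a unique minimizer over $\mathbb{R}^n\times\mathbb{R}^{2p}$, denoted $(x(\mu),z(\mu))$, and $z(\mu)>0$ componentwise. Set $s(\mu)=\frac{\mu}{2p}Z(\mu)^{-1}e$ with $Z(\mu)=\operatorname{diag}(z(\mu))$, and let $u(\mu)\in\mathbb{R}^p$ be the unique vector such that $Qx(\mu)-c-Du(\mu)=0$ and $\lambda e-s(\mu)-\tilde I^*u(\mu)=0$ (KKT multiplier). Analytic centers: let $\overline I=\{i:\ z_i>0\text{ for some }(x,z)\in S_{(P)}\}$ and $\overline J=\{i:\ s_i>0\text{ for some }(x,s,u)\in S_{(D)}\}$. For $K\in\{\overline I,\overline J\}$ and $w\in\mathbb{R}^{K}$, let $\varphi_K(w)=\big(\prod_{i\in K}w_i\big)^{1/\operatorname{card}(K)}$ if $w_i>0$ for all $i\in K$, and $\varphi_K(w)=-\infty$ otherwise (with the convention that $\varphi_K$ is the constant $1$ if $K=\emptyset$). Then $(\overline x,\overline z)$ is the unique maximizer of $\varphi_{\overline I}(z_{\overline I})$ over all $(x,z)\in\mathbb{R}^n\times[0,+\infty)^{2p}$ satisfying $\frac12\langle Qx,x\rangle-\langle c,x\rangle+\lambda\langle e,z\rangle=\alpha$, $D^*x+\tilde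 I z=0$ and $z_{\overline J}=0$; and $(\overline s,\overline u)$ is the unique maximizer of $\varphi_{\overline J}(s_{\overline J})$ over all $(s,u)\in[0,+\infty)^{2p}\times\mathbb{R}^p$ satisfying $s=\lambda e-\tilde I^*u$, $Du+c-Q\overline x=0$ and $s_{\overline I}=0$. *)

(* Defs.v *)
From HB Require Import structures.
From mathcomp Require Import all_boot all_order all_algebra.
From mathcomp Require Import all_classical all_reals all_analysis.
Set Implicit Arguments.
Unset Strict Implicit.
Unset Printing Implicit Defensive.
Import Order.TTheory GRing.Theory Num.Theory.
Import numFieldNormedType.Exports.
Local Open Scope classical_set_scope.
Local Open Scope ring_scope.

Definition minimizer (T : Type) (R : realType) (A : set T) (F : T -> \bar R)
    (a : T) : Prop :=
  A a /\ forall b, A b -> (F a <= F b)%E.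

Definition maximizer (T : Type) (R : realType) (A : set T) (F : T -> \bar R)
    (a : T) : Prop :=
  A a /\ forall b, A b -> (F b <= F a)%E.

Definition affine_hull (R : realType) (E : normedModType R) (A : set E)
    : set E :=
  [set v | exists (k : nat) (t : 'I_k -> R) (w : 'I_k -> E),
     [/\ forall i, A (w i), \sum_(i < k) t i = 1
       & v = \sum_(i < k) t i *: w i]].

(* The interior of A for the topology induced on its affine hull. *)
Definition relative_interior (R : realType) (E : normedModType R) (A : set E)
    : set E :=
  [set v | A v /\ within (affine_hull A) (nbhs v) A].

Definition inner (R : realType) (m : nat) (a b : 'cV[R]_m) : R :=
  \sum_(i < m) a i ord0 * b i ord0.

Definition orthant (R : realType) (m : nat) : set 'cV[R]_m :=
  [set z | forall i, 0 <= z i ord0].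
Arguments orthant : clear implicits.

(* If K = set0 the value is 1: the product is empty and the exponent is 0. *)
Definition geomean (R : realType) (m : nat) (K : {set 'I_m}) (w : 'cV[R]_m)
    : \bar R :=
  if [forall i in K, 0 < w i ord0]
  then ((\prod_(i in K) w i ord0) `^ (#|K|%:R^-1))%:E else -oo%E.

Section Problem.
Variables (R : realType) (n p q : nat).
Variables (Phi : 'M[R]_(q, n)) (y : 'cV[R]_q) (D : 'M[R]_(n, p)) (lambda : R).

Definition Qmx : 'M[R]_n := Phi^T *m Phi.

Definition cvec : 'cV[R]_n := Phi^T *m y.

Definition Itilde : 'M[R]_(p, p + p) := row_mx 1%:M (- 1%:M).

Definition evec : 'cV[R]_(p + p) := const_mx 1.

Definition primal_value (x : 'cV[R]_n) (z : 'cV[R]_(p + p)) : R :=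
  2^-1 * inner (Qmx *m x) x - inner cvec x + lambda * inner evec z.

Definition f_primal (x : 'cV[R]_n) (z : 'cV[R]_(p + p)) : \bar R :=
  if D^T *m x + Itilde *m z == 0 then (primal_value x z)%:E else +oo%E.

Definition g_dual (x : 'cV[R]_n) (s : 'cV[R]_(p + p)) (u : 'cV[R]_p)
    : \bar R :=
  if (D *m u + cvec - Qmx *m x == 0)
     && (s == lambda *: evec - Itilde^T *m u)
  then (- (2^-1 * inner (Qmx *m x) x))%:E else -oo%E.

Definition dom_primal : set ('cV[R]_n * 'cV[R]_(p + p)) :=
  [set w | orthant R (p + p) w.2].

Definition dom_dual : set ('cV[R]_n * 'cV[R]_(p + p) * 'cV[R]_p) :=
  [set w | orthant R (p + p) w.1.2].

Definition sol_primal : set ('cV[R]_n * 'cV[R]_(p + p)) :=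
  [set w | minimizer dom_primal (fun w => f_primal w.1 w.2) w].

Definition sol_dual : set ('cV[R]_n * 'cV[R]_(p + p) * 'cV[R]_p) :=
  [set w | maximizer dom_dual (fun w => g_dual w.1.1 w.1.2 w.2) w].

(* By strong duality this is also the optimal value of the dual problem. *)
Definition opt_value : \bar R :=
  ereal_inf [set f_primal w.1 w.2 | w in dom_primal].

Definition xi (z : 'cV[R]_(p + p)) : \bar R :=
  if [forall i, 0 < z i ord0]
  then (- ln ((\prod_i z i ord0) `^ ((2 * p)%:R^-1)))%:E else +oo%E.

Definition F_barrier (mu : R) (x : 'cV[R]_n) (z : 'cV[R]_(p + p)) : \bar R :=
  (f_primal x z + mu%:E * xi (mu^-1 *: z))%E.

Definition slack (mu : R) (z : 'cV[R]_(p + p)) : 'cV[R]_(p + p) :=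
  (mu / (2 * p)%:R) *: (invmx (diag_mx z^T) *m evec).

Definition Ibar : {set 'I_(p + p)} :=
  finset (fun i => `[< exists x z, sol_primal (x, z) /\ 0 < z i ord0 >]).

Definition Jbar : {set 'I_(p + p)} :=
  finset (fun i => `[< exists x s u, sol_dual (x, s, u) /\ 0 < s i ord0 >]).

Definition primal_center_dom : set ('cV[R]_n * 'cV[R]_(p + p)) :=
  [set w | [/\ orthant R (p + p) w.2,
               (primal_value w.1 w.2)%:E = opt_value,
               D^T *m w.1 + Itilde *m w.2 = 0
             & forall i, i \in Jbar -> w.2 i ord0 = 0]].

Definition dual_center_dom (xbar : 'cV[R]_n)
    : set ('cV[R]_(p + p) * 'cV[R]_p) :=
  [set w | [/\ orthant R (p + p) w.1,
               w.1 = lambda *: evec - Itilde^T *m w.2,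
               D *m w.2 + cvec - Qmx *m xbar = 0
             & forall i, i \in Ibar -> w.1 i ord0 = 0]].

Definition primal_center (xbar : 'cV[R]_n) (zbar : 'cV[R]_(p + p)) : Prop :=
  maximizer primal_center_dom (fun w => geomean Ibar w.2) (xbar, zbar).

Definition dual_center (xbar : 'cV[R]_n) (sbar : 'cV[R]_(p + p))
    (ubar : 'cV[R]_p) : Prop :=
  maximizer (dual_center_dom xbar) (fun w => geomean Jbar w.1) (sbar, ubar).

End Problem.

(* Main.v *)
Require Import Defs.
From HB Require Import structures.
From mathcomp Require Import all_boot all_order all_algebra.
From mathcomp Require Import all_classical all_reals all_analysis.
From mathcomp Require Import ring lra.
Set Implicit Arguments.
Unset Strict Implicit.
Unset Printing Implicit Defensive.
Import Order.TTheory GRing.Theory Num.Theory.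
Import numFieldNormedType.Exports.
Local Open Scope classical_set_scope.
Local Open Scope ring_scope.

(** Write (P), (D) for the two problems, I for [Ibar] and J for [Jbar].

    Duality is exact.  For a primal feasible (x, z) and a dual feasible (x',
    s, u), the difference of the two objectives is <s, z> + |Phi (x - x')|^2
    / 2 ([duality_gap]).  The two centers are feasible and complementary,
    since z vanishes off I and s vanishes on I; so they form a KKT
    quadruple, and both solution sets are described by it: same image under
    Phi, feasibility, and complementarity ([sol_primalP], [sol_dualP]).

    The barrier minimizers, together with s(mu) and u(mu), form the central
    path: feasible on both sides, with s_i z_i = mu / 2p for all i.
    Monotonicity of the optimality system turns this into the identity
      <s(mu), z0> + <s0, z(mu)> + |Phi (x(mu) - x0)|^2 = mu
    for every KKT quadruple (x0, z0, s0, u0) ([central_identity]).  It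
    bounds the path, and it gives z0_i <= 2p z_i(mu) and s0_i <= 2p s_i(mu),
    so that limits of the path are positive on I, respectively on J.

    It remains to identify the limits.  Let U be an ultrafilter refining mu
    -> 0+. Along U the path converges, by boundedness, to some KKT quadruple
    (xh, zh, sh, uh) ([path_subconverges]).  A dual feasible slack takes the
    same value on all primal solutions ([primal_slack_invariant]); applied
    to s(mu) this reads, for every mu,
      sum_(i in I) zbar_i / z_i(mu) = sum_(i in I) zh_i / z_i(mu),
    because s_i(mu) is proportional to 1 / z_i(mu) and primal solutions
    vanish off I.  In the limit the ratios zbar_i / zh_i have mean 1 over I,
    while their geometric mean is at least 1 because zbar maximizes it; the
    equality case of the AM-GM inequality forces zbar = zh
    ([geomean_unique]).  The same argument with the roles of z and s
    exchanged gives sbar = sh, and x and u are determined by z, s and Phi x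
    ([path_limit]).  All ultrafilter limits agree, so the path converges
    ([cvg_ultra]).

    Finally, zbar = zh is positive on I.  Points of the affine hull of the
    primal solution set satisfy every equation in its description and vanish
    off I; near (xbar, zbar) they stay positive on I, hence are solutions.
    The same holds for the dual. *)

(** * The inner product *)

Section Inner.
Variable R : realType.

Lemma innerE m (a b : 'cV[R]_m) : inner a b = (a^T *m b) ord0 ord0.
Proof. by rewrite /inner mxE; apply: eq_bigr => i _; rewrite mxE. Qed.

Lemma innerC m (a b : 'cV[R]_m) : inner a b = inner b a.
Proof. by apply: eq_bigr => i _; rewrite mulrC. Qed.

Lemma innerDl m (a b c : 'cV[R]_m) : inner (a + b) c = inner a c + inner b c.
Proof.
by rewrite /inner -big_split; apply: eq_bigr => i _; rewrite mxE mulrDl.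
Qed.

Lemma innerNl m (a c : 'cV[R]_m) : inner (- a) c = - inner a c.
Proof. by rewrite /inner -sumrN; apply: eq_bigr => i _; rewrite mxE mulNr. Qed.

Lemma innerBl m (a b c : 'cV[R]_m) : inner (a - b) c = inner a c - inner b c.
Proof. by rewrite innerDl innerNl. Qed.

Lemma innerZl m k (a c : 'cV[R]_m) : inner (k *: a) c = k * inner a c.
Proof.
by rewrite /inner mulr_sumr; apply: eq_bigr => i _; rewrite mxE mulrA.
Qed.

Lemma inner0l m (c : 'cV[R]_m) : inner 0 c = 0.
Proof. by apply: big1 => i _; rewrite mxE mul0r. Qed.

Lemma innerDr m (a b c : 'cV[R]_m) : inner c (a + b) = inner c a + inner c b.
Proof. by rewrite !(innerC c) innerDl. Qed.

Lemma innerNr m (a c : 'cV[R]_m) : inner c (- a) = - inner c a.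
Proof. by rewrite !(innerC c) innerNl. Qed.

Lemma innerBr m (a b c : 'cV[R]_m) : inner c (a - b) = inner c a - inner c b.
Proof. by rewrite !(innerC c) innerBl. Qed.

Lemma inner_mulmx m k (A : 'M[R]_(m, k)) a b :
  inner (A *m a) b = inner a (A^T *m b).
Proof. by rewrite !innerE trmx_mul mulmxA. Qed.

Lemma inner_ge0 m (a b : 'cV[R]_m) :
  orthant R m a -> orthant R m b -> 0 <= inner a b.
Proof. by move=> a0 b0; apply: sumr_ge0 => i _; exact: mulr_ge0. Qed.

Lemma inner_eq0P m (a b : 'cV[R]_m) : orthant R m a -> orthant R m b ->
  inner a b = 0 <-> forall i, a i ord0 * b i ord0 = 0.
Proof.
move=> a0 b0; split=> [ab0 i|ab0]; last by rewrite /inner big1.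
by apply: (psumr_eq0P _ ab0) => // j _; exact: mulr_ge0.
Qed.

Lemma inner_ge_term m (a b : 'cV[R]_m) i :
  orthant R m a -> orthant R m b -> a i ord0 * b i ord0 <= inner a b.
Proof.
move=> a0 b0; rewrite /inner (bigD1 i) //= lerDl.
by apply: sumr_ge0 => j _; exact: mulr_ge0.
Qed.

Lemma inner_sq_ge0 m (a : 'cV[R]_m) : 0 <= inner a a.
Proof. by apply: sumr_ge0 => i _; rewrite -expr2 sqr_ge0. Qed.

Lemma inner_sq_eq0 m (a : 'cV[R]_m) : inner a a = 0 -> a = 0.
Proof.
move=> a0; apply/colP => i; rewrite mxE; apply/eqP.
rewrite -(sqrf_eq0 (a i ord0)) expr2; apply/eqP.
by apply: (psumr_eq0P _ a0) => // j _; rewrite -expr2 sqr_ge0.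
Qed.

End Inner.

(** * Duality and optimality conditions *)

Section Duality.
Variables (R : realType) (n p q : nat).
Variables (Phi : 'M[R]_(q, n)) (y : 'cV[R]_q) (D : 'M[R]_(n, p)) (lambda : R).

Local Notation Q := (Qmx Phi).
Local Notation c := (cvec Phi y).
Local Notation It := (Itilde R p).
Local Notation e := (evec R p).
Local Notation SP := (sol_primal Phi y D lambda).
Local Notation SD := (sol_dual Phi y D lambda).

Definition primal_feasible (x : 'cV[R]_n) (z : 'cV[R]_(p + p)) : Prop :=
  orthant R (p + p) z /\ D^T *m x + It *m z = 0.

Definition dual_feasible (x : 'cV[R]_n) (s : 'cV[R]_(p + p)) (u : 'cV[R]_p) :
    Prop :=
  [/\ orthant R (p + p) s, D *m u + c - Q *m x = 0
    & s = lambda *: e - It^T *m u].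

Lemma inner_Qmx x x' : inner (Q *m x) x' = inner (Phi *m x) (Phi *m x').
Proof. by rewrite /Qmx -mulmxA (inner_mulmx Phi^T) trmxK. Qed.

Lemma Qmx_gradient x x' :
  inner (Q *m x - c) x' = inner (Phi *m x - y) (Phi *m x').
Proof.
by rewrite innerBl innerBl inner_Qmx /cvec (inner_mulmx Phi^T) trmxK.
Qed.

(** The linear part of the dual constraints, read against a direction of the
    primal constraint: the multiplier u is eliminated.  Every identity between
    slacks and primal variables below is a combination of instances of it. *)
Lemma slack_pairing x s u dx dz :
  D *m u + c - Q *m x = 0 -> s = lambda *: e - It^T *m u ->
  D^T *m dx + It *m dz = 0 ->
  inner s dz = lambda * inner e dz + inner (Q *m x - c) dx.
Proof.
move=> Du -> /eqP; rewrite addr_eq0 => /eqP Ddx.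
rewrite innerBl innerZl inner_mulmx trmxK.
have -> : Q *m x - c = D *m u.
  apply/eqP; rewrite -subr_eq0 -oppr_eq0 -Du.
  by apply/eqP; rewrite !opprB addrA.
by rewrite inner_mulmx Ddx innerNr.
Qed.

(** Weak duality with its exact defect: the gap closes iff the points are
    complementary and have the same image under Phi. *)
Lemma duality_gap x z x' s u : primal_feasible x z -> dual_feasible x' s u ->
  primal_value Phi y lambda x z + 2^-1 * inner (Q *m x') x'
    = inner s z + 2^-1 * inner (Phi *m (x - x')) (Phi *m (x - x')).
Proof.
move=> [_ Pz] [_ Du sE]; rewrite (slack_pairing Du sE Pz) /primal_value.
rewrite innerBl mulmxBr !innerBl !innerBr !inner_Qmx.
rewrite (innerC (Phi *m x) (Phi *m x')); lra.
Qed.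

Definition kkt x z s u :=
  [/\ primal_feasible x z, dual_feasible x s u & inner s z = 0].

Lemma f_primal_feasible x z : primal_feasible x z ->
  f_primal Phi y D lambda x z = (primal_value Phi y lambda x z)%:E.
Proof. by move=> [_ /eqP xz]; rewrite /f_primal xz. Qed.

Lemma g_dual_feasible x s u : dual_feasible x s u ->
  g_dual Phi y D lambda x s u = (- (2^-1 * inner (Q *m x) x))%:E.
Proof. by move=> [_ /eqP Du /eqP sE]; rewrite /g_dual Du sE. Qed.

(** The gap to the dual point of a KKT quadruple vanishes exactly at the
    minimizers. *)
Lemma sol_primalP x0 z0 s0 u0 x z : kkt x0 z0 s0 u0 ->
  SP (x, z) <-> [/\ primal_feasible x z, Phi *m x = Phi *m x0
                  & inner s0 z = 0].
Proof.
move=> [P0 D0 sz0]; split.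
- move=> [/= z_ge0 min_xz].
  have /= := min_xz (x0, z0) P0.1; rewrite (f_primal_feasible P0).
  have [xz0|] := boolP (D^T *m x + It *m z == 0); last first.
    by move=> /negbTE xz0; rewrite /f_primal xz0 leye_eq.
  have Pxz : primal_feasible x z by split=> //; exact/eqP.
  rewrite (f_primal_feasible Pxz) lee_fin => le_val.
  have := duality_gap Pxz D0; have := duality_gap P0 D0.
  have := inner_ge0 (let: And3 h _ _ := D0 in h) z_ge0.
  have := inner_sq_ge0 (Phi *m (x - x0)).
  rewrite sz0 subrr mulmx0 inner0l => h1 h2 h3 h4.
  split=> //; last lra.
  apply/eqP; rewrite -subr_eq0 -mulmxBr; apply/eqP; apply: inner_sq_eq0; lra.
- move=> [Pxz Exx0 s0z]; split=> [/=|[x' z'] /= z'_ge0]; first exact: Pxz.1.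
  rewrite (f_primal_feasible Pxz).
  have [xz0|] := boolP (D^T *m x' + It *m z' == 0); last first.
    by move=> /negbTE xz0; rewrite /f_primal xz0 leey.
  have Pxz' : primal_feasible x' z' by split=> //; exact/eqP.
  rewrite (f_primal_feasible Pxz') lee_fin.
  have := duality_gap Pxz D0; have := duality_gap Pxz' D0.
  have := inner_ge0 (let: And3 h _ _ := D0 in h) z'_ge0.
  have := inner_sq_ge0 (Phi *m (x' - x0)).
  rewrite s0z [Phi *m (x - x0)]mulmxBr Exx0 subrr.
  rewrite inner0l; lra.
Qed.

Lemma sol_dualP x0 z0 s0 u0 x s u : kkt x0 z0 s0 u0 ->
  SD (x, s, u) <-> [/\ dual_feasible x s u, Phi *m x = Phi *m x0
                     & inner s z0 = 0].
Proof.
move=> [P0 D0 sz0]; have := duality_gap P0 D0.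
rewrite sz0 subrr mulmx0 inner0l => gap0.
split.
- move=> [/= s_ge0 max_xsu].
  have /= := max_xsu (x0, s0, u0) (let: And3 h _ _ := D0 in h).
  rewrite (g_dual_feasible D0).
  have [/andP[/eqP Du /eqP sE]|] := boolP ((D *m u + c - Q *m x == 0)
     && (s == lambda *: e - It^T *m u)); last first.
    by move=> /negbTE xs0; rewrite /g_dual xs0 leeNy_eq.
  have Dxs : dual_feasible x s u by [].
  rewrite (g_dual_feasible Dxs) lee_fin => le_val.
  have := duality_gap P0 Dxs.
  have := inner_ge0 s_ge0 P0.1.
  have := inner_sq_ge0 (Phi *m (x0 - x)) => h1 h2 h3.
  split=> //; last lra.
  apply/esym/eqP; rewrite -subr_eq0 -mulmxBr; apply/eqP; apply: inner_sq_eq0.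
  lra.
- move=> [Dxs Exx0 sz]; split=> [/=|[[x' s'] u'] /= s'_ge0]; first by case: Dxs.
  rewrite (g_dual_feasible Dxs).
  have [/andP[/eqP Du /eqP sE]|] := boolP ((D *m u' + c - Q *m x' == 0)
     && (s' == lambda *: e - It^T *m u')); last first.
    by move=> /negbTE xs0; rewrite /g_dual xs0 leNye.
  have Dxs' : dual_feasible x' s' u' by [].
  rewrite (g_dual_feasible Dxs') lee_fin.
  have := duality_gap P0 Dxs; have := duality_gap P0 Dxs'.
  have := inner_ge0 s'_ge0 P0.1.
  have := inner_sq_ge0 (Phi *m (x0 - x')).
  rewrite sz [Phi *m (x0 - x)]mulmxBr Exx0 subrr inner0l; lra.
Qed.

Lemma kkt_sol x z s u : kkt x z s u -> SP (x, z) /\ SD (x, s, u).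
Proof.
by move=> K; split; [apply/(sol_primalP _ _ K)|apply/(sol_dualP _ _ _ K)];
  case: K.
Qed.

Lemma dual_feasible_image x x0 s u :
  Phi *m x = Phi *m x0 -> dual_feasible x0 s u -> dual_feasible x s u.
Proof. by move=> Ex [? + ?]; split=> //; rewrite /Qmx -mulmxA Ex mulmxA. Qed.

(** Solutions may be exchanged one side at a time: any primal solution is
    complementary to any dual solution. *)
Lemma kkt_exchange_primal x0 z0 s0 u0 x z :
  kkt x0 z0 s0 u0 -> SP (x, z) -> kkt x z s0 u0.
Proof.
move=> K /(sol_primalP _ _ K)[Pxz Ex sz]; case: K => _ D0 _.
by split=> //; apply: dual_feasible_image D0.
Qed.

Lemma kkt_exchange_dual x0 z0 s0 u0 x s u :
  kkt x0 z0 s0 u0 -> SD (x, s, u) -> kkt x0 z0 s u.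
Proof.
move=> K /(sol_dualP _ _ _ K)[Dxs Ex sz]; case: K => P0 _ _.
by split=> //; apply: dual_feasible_image Dxs.
Qed.

Lemma kkt_compl x z s u i : kkt x z s u -> s i ord0 * z i ord0 = 0.
Proof. by move=> [[z0 _] [s0 _ _] /(inner_eq0P s0 z0)]. Qed.

Lemma sol_primal_opt_value x z :
  SP (x, z) -> f_primal Phi y D lambda x z = opt_value Phi y D lambda.
Proof.
move=> [/= z_ge0 min_xz]; apply/eqP; rewrite eq_le; apply/andP; split.
  by apply: le_ereal_inf_tmp => _ [[x' z'] /= ? <-]; exact: (min_xz (x', z')).
by apply: ereal_inf_lbound; exists (x, z).
Qed.

Lemma sol_primal_off_Ibar x z i : orthant R (p + p) z -> SP (x, z) ->
  i \notin Ibar Phi y D lambda -> z i ord0 = 0.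
Proof.
move=> z_ge0 Sxz /negP iI; apply/eqP; rewrite eq_le z_ge0 andbT leNgt.
by apply/negP => zi; apply: iI; rewrite inE; apply/asboolP; exists x, z.
Qed.

Lemma sol_dual_off_Jbar x s u i : orthant R (p + p) s -> SD (x, s, u) ->
  i \notin Jbar Phi y D lambda -> s i ord0 = 0.
Proof.
move=> s_ge0 Sxs /negP iJ; apply/eqP; rewrite eq_le s_ge0 andbT leNgt.
by apply/negP => si; apply: iJ; rewrite inE; apply/asboolP; exists x, s, u.
Qed.

(** This is where strong duality comes from: zbar is itself a primal solution,
    so it vanishes off I, while sbar vanishes on I; the two are complementary,
    and the duality gap is zero. *)
Lemma center_dom_kkt xbar zbar sbar ubar :
  primal_center_dom Phi y D lambda (xbar, zbar) ->
  dual_center_dom Phi y D lambda xbar (sbar, ubar) ->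
  kkt xbar zbar sbar ubar.
Proof.
move=> [/= z_ge0 val_bar Pz _] [/= s_ge0 sE Du sI].
have P : primal_feasible xbar zbar by [].
split=> //; apply/inner_eq0P => // i.
have [iI|iI] := boolP (i \in Ibar Phi y D lambda).
  by rewrite sI // mul0r.
rewrite (@sol_primal_off_Ibar xbar zbar i z_ge0 _ iI) ?mulr0 //.
split=> // -[x' z'] /= z'_ge0; rewrite f_primal_feasible // val_bar.
by apply: ereal_inf_lbound; exists (x', z').
Qed.

Lemma kkt_primal_center_dom x z s u :
  kkt x z s u -> primal_center_dom Phi y D lambda (x, z).
Proof.
move=> K; have [Sxz Sxs] := kkt_sol K; have [P _ _] := K.
split=> [||| i]; [exact: P.1| |exact: P.2|].
  by rewrite -(sol_primal_opt_value Sxz) f_primal_feasible.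
rewrite inE => /asboolP[x' [s' [u' [Sxs' s'i]]]].
have /eqP := kkt_compl i (kkt_exchange_dual K Sxs').
by rewrite mulf_eq0 gt_eqF //= => /eqP.
Qed.

Lemma kkt_dual_center_dom xbar x z s u : kkt x z s u ->
  Phi *m xbar = Phi *m x -> dual_center_dom Phi y D lambda xbar (s, u).
Proof.
move=> K Ex; have [_ D0 _] := K.
have [s_ge0 Du sE] := dual_feasible_image Ex D0.
split=> //= i; rewrite inE => /asboolP[x' [z' [Sxz' z'i]]].
have /eqP := kkt_compl i (kkt_exchange_primal K Sxz').
by rewrite mulf_eq0 orbC gt_eqF //= => /eqP.
Qed.

(** * The central path *)

Definition central mu x z s u :=
  [/\ primal_feasible x z, dual_feasible x s u,
      forall i, 0 < z i ord0, forall i, 0 < s i ord0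
    & forall i, s i ord0 * z i ord0 = mu / (2 * p)%:R].

(** With differences dx, dz, ds: <ds, dz> = <Q dx, dx> = |Phi dx|^2, because the
    contribution of the multipliers cancels between the two constraints. *)
Lemma primal_dual_monotonicity x z s u x0 z0 s0 u0 :
  primal_feasible x z -> dual_feasible x s u ->
  primal_feasible x0 z0 -> dual_feasible x0 s0 u0 ->
  inner s z + inner s0 z0
    = inner s z0 + inner s0 z + inner (Phi *m (x - x0)) (Phi *m (x - x0)).
Proof.
move=> [_ Pz] [_ Du sE] [_ Pz0] [_ Du0 s0E].
rewrite (slack_pairing Du sE Pz) (slack_pairing Du0 s0E Pz).
rewrite (slack_pairing Du sE Pz0).
rewrite (slack_pairing Du0 s0E Pz0) mulmxBr !innerBl !innerBr !inner_Qmx.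
rewrite (innerC (Phi *m x0) (Phi *m x)); ring.
Qed.

Section PathBounds.
Hypothesis p_gt0 : (0 < p)%N.
Variables (mu : R) (x x0 : 'cV[R]_n) (z z0 s s0 : 'cV[R]_(p + p)).
Variables (u u0 : 'cV[R]_p).
Hypotheses (C : central mu x z s u) (K : kkt x0 z0 s0 u0).

Let natp_gt0 : 0 < (2 * p)%:R :> R.
Proof. by rewrite ltr0n muln_gt0. Qed.

Lemma central_gap : inner s z = mu.
Proof.
case: C => _ _ _ _ sz; rewrite /inner (eq_bigr _ (fun i _ => sz i)).
rewrite sumr_const card_ord -(mulr_natr (mu / _)) [X in _ * X%:R]addnn.
by rewrite -mul2n divfK // lt0r_neq0.
Qed.

Lemma central_identity :
  inner s z0 + inner s0 z + inner (Phi *m (x - x0)) (Phi *m (x - x0)) = mu.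
Proof.
case: C => Px Dx _ _ _; case: K => P0 D0 sz0.
by rewrite -(primal_dual_monotonicity Px Dx P0 D0) sz0 addr0 central_gap.
Qed.

Let terms_ge0 : [/\ 0 <= inner s z0, 0 <= inner s0 z
  & 0 <= inner (Phi *m (x - x0)) (Phi *m (x - x0))].
Proof.
case: C => Px [? _ _] _ _ _; case: K => P0 [? _ _] _.
split; last exact: inner_sq_ge0; apply: inner_ge0 => //.
- exact: P0.1.
- exact: Px.1.
Qed.

Lemma central_image_bound :
  inner (Phi *m (x - x0)) (Phi *m (x - x0)) <= mu.
Proof. have [] := terms_ge0; have := central_identity; lra. Qed.

(** In [central_identity] the single term s_i z0_i = (mu / 2p) z0_i / z_i is at
    most mu, which keeps z_i away from 0 wherever z0_i > 0. *)
Lemma central_primal_ge i : z0 i ord0 <= (2 * p)%:R * z i ord0.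
Proof.
have [h1 h2 h3] := terms_ge0; have id := central_identity.
case: C => _ [s_ge0 _ _] zpos spos sz; case: K => P0 _ _.
have := inner_ge_term i s_ge0 P0.1 => h4.
have -> : (2 * p)%:R * z i ord0 = mu / s i ord0.
  rewrite -[mu](divfK (lt0r_neq0 natp_gt0)) -(sz i).
  have := lt0r_neq0 (spos i); move=> ?; field; done.
rewrite ler_pdivlMr // mulrC; lra.
Qed.

Lemma central_dual_ge i : s0 i ord0 <= (2 * p)%:R * s i ord0.
Proof.
have [h1 h2 h3] := terms_ge0; have id := central_identity.
case: C => P _ zpos spos sz; case: K => _ [s0_ge0 _ _] _.
have := inner_ge_term i s0_ge0 P.1 => h4.
have -> : (2 * p)%:R * s i ord0 = mu / z i ord0.
  rewrite -[mu](divfK (lt0r_neq0 natp_gt0)) -(sz i).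
  have := lt0r_neq0 (zpos i); move=> ?; field; done.
rewrite ler_pdivlMr //; lra.
Qed.

(** The excess of lambda <e, z> over lambda <e, z0> is
    <s0, z> - <Phi x0 - y, Phi (x - x0)>; Young's inequality bounds the second
    term by quantities controlled by [central_identity]. *)
Lemma central_primal_bound :
  lambda * inner e z <= lambda * inner e z0 + mu
    + 2^-1 * inner (Phi *m x0 - y) (Phi *m x0 - y).
Proof.
have [h1 h2 h3] := terms_ge0; have id := central_identity.
case: C => -[_ Px] _ _ _ _; case: K => -[_ P0] [_ Du sE] sz0.
have := slack_pairing Du sE Px; have := slack_pairing Du sE P0.
rewrite !Qmx_gradient sz0.
(* Young's inequality, as the nonnegativity of this square *)
have := inner_sq_ge0 (Phi *m x0 - y + Phi *m (x - x0)).
move: id h3; rewrite mulmxBr.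
move: (Phi *m x) (Phi *m x0) => b b0.
rewrite !(innerDl, innerDr, innerNl, innerNr) (innerC b b0)
  (innerC b y) (innerC b0 y).
lra.
Qed.

End PathBounds.

End Duality.

(** * Limits along ultrafilters *)

Section Limits.

(** If f does not converge along F, then F together with the complement of some
    f @^-1` A, with A a neighborhood of l, generates a proper filter; an
    ultrafilter refining it contradicts the hypothesis. *)
Lemma cvg_ultra (T : Type) (U : topologicalType) (F : set_system T)
    (f : T -> U) (l : U) : ProperFilter F ->
  (forall G, UltraFilter G -> F `<=` G -> f @ G --> l) -> f @ F --> l.
Proof.
move=> FF ultra_cvg A lA; apply: contrapT => nFA.
have PW : ProperFilter (within (~` (f @^-1` A)) F).
  split=> [|]; last exact: within_filter.
  rewrite /within /= => W0; apply: nFA.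
  by apply: filterS W0 => t /= ?; exact: contrapT.
have [G [UG sG]] := ultraFilterLemma PW.
have GA : G (f @^-1` A).
  apply: (ultra_cvg G UG _ _ lA) => B FB; apply: sG.
  by apply: filterS FB => t Bt _.
have GnA : G (~` (f @^-1` A)) by apply: sG; exact: withinT.
by have [t []] := filter_ex (filterI GA GnA).
Qed.

Variable R : realType.

Lemma cvg_mx (T : Type) (F : set_system T) {FF : Filter F} (m k : nat)
    (f : T -> 'M[R]_(m, k)) (M : 'M[R]_(m, k)) :
  (forall i j, (fun t => f t i j) @ F --> M i j) -> f @ F --> M.
Proof.
move=> fM A [P MP sPA].
have FP : F [set t | forall i j, P i j (f t i j)].
  apply: filter_forall => i; apply: filter_forall => j.
  exact: (fM i j _ (MP i j)).
suff : F (f @^-1` A) by []; apply: filterS FP => t Pt; exact: sPA.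
Qed.

Lemma cvg_mx_entry (T : Type) (F : set_system T) {FF : Filter F} (m k : nat)
    (f : T -> 'M[R]_(m, k)) (M : 'M[R]_(m, k)) i j :
  f @ F --> M -> (fun t => f t i j) @ F --> M i j.
Proof.
move=> fM.
exact: (continuous_cvg _ (@coord_continuous R m k i j M) fM).
Qed.

Lemma cvg_mulmx (T : Type) (F : set_system T) {FF : Filter F} (m k l : nat)
    (A : 'M[R]_(m, k)) (f : T -> 'M[R]_(k, l)) (M : 'M[R]_(k, l)) :
  f @ F --> M -> (fun t => A *m f t) @ F --> A *m M.
Proof.
move=> fM; apply: cvg_mx => i j; rewrite mxE.
under eq_fun do rewrite mxE.
apply: (@cvg_big R _ +%R 0 xpredT (@add_continuous R)) => h _.
by apply: cvgM; [exact: cvg_cst|exact: cvg_mx_entry].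
Qed.

(** Compactness of a segment, coordinate by coordinate: the image of an
    ultrafilter is an ultrafilter, so no subsequence has to be extracted. *)
Lemma ultra_bounded_cvg (T : Type) (U : set_system T) (m : nat)
    (f : T -> 'cV[R]_m) (b : R) : UltraFilter U ->
  (\forall t \near U, forall i, `|f t i ord0| <= b) ->
  exists M : 'cV[R]_m, f @ U --> M.
Proof.
move=> UU fb.
have ex_lim i : exists l : R, (fun t => f t i ord0) @ U --> l.
  have := @segment_compact R (- b) b; rewrite compact_ultra.
  move=> /(_ ((fun t => f t i ord0) @ U)) [].
  - split=> [|G PG sUG]; first exact: fmap_proper_filter.
    apply/seteqP; split=> // A GA.
    have [//|UnA] := in_ultra_setVsetC ((fun t => f t i ord0) @^-1` A) UU.
    have GnA : G (~` A) by exact: sUG.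
    by have [t []] := filter_ex (filterI GA GnA).
  - by apply: filterS fb => t /(_ i) /=; rewrite in_itv /= -ler_norml.
  - by move=> l [_ ?]; exists l.
have [l fl] := choice ex_lim.
exists (\col_i l i); apply: cvg_mx => i j; rewrite mxE (ord1 j); exact: fl.
Qed.

Lemma near_cvg_eq (T : Type) (F : set_system T) {FF : ProperFilter F}
    (V : pseudoMetricNormedZmodType R) (f g : T -> V) (a b : V) :
  (\forall t \near F, f t = g t) -> f @ F --> a -> g @ F --> b -> a = b.
Proof.
move=> fg fa gb; apply: (cvg_unique (@norm_hausdorff _ V) fa).
apply: cvg_trans gb; apply: near_eq_cvg.
by apply: filterS fg => t ->.
Qed.

End Limits.
(** * Geometric means and analytic centers *)

Section Center.
Variable R : realType.

Lemma geomean_pos m (K : {set 'I_m}) (w : 'cV[R]_m) :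
  (forall i, i \in K -> 0 < w i ord0) ->
  geomean K w = ((\prod_(i in K) w i ord0) `^ (#|K|%:R^-1))%:E.
Proof. by move=> w0; rewrite /geomean ifT //; exact/forall_inP. Qed.

Lemma geomean_le m (K : {set 'I_m}) (w wb : 'cV[R]_m) :
  (forall i, i \in K -> 0 < w i ord0) ->
  (geomean K w <= geomean K wb)%E ->
  (forall i, i \in K -> 0 < wb i ord0) /\
  \prod_(i in K) w i ord0 <= \prod_(i in K) wb i ord0.
Proof.
move=> w0; rewrite geomean_pos // /geomean.
case: ifPn => [/forall_inP wb0|_]; last by rewrite leeNy_eq.
rewrite lee_fin => le_mean; split=> //.
have [K0|K_gt0] := posnP #|K|.
  by rewrite (cards0_eq K0) !big_set0.
have K_neq0 : #|K|%:R != 0 :> R by rewrite pnatr_eq0 -lt0n.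
have prod_ge0 (v : 'cV[R]_m) : (forall i, i \in K -> 0 < v i ord0) ->
    0 <= \prod_(i in K) v i ord0.
  by move=> v0; apply: prodr_ge0 => i iK; exact/ltW/v0.
have := @ge0_ler_powR R #|K|%:R (ler0n _ _) _ _ _ _ le_mean.
rewrite -!powRrM mulVf // !powRr1 ?prod_ge0 //.
by apply; rewrite nnegrE powR_ge0.
Qed.

(** The equality case of the AM-GM inequality for the ratios wb_i / w_i, whose
    arithmetic mean is 1 and whose product is at least 1. *)
Lemma geomean_unique m (K : {set 'I_m}) (w wb : 'cV[R]_m) :
  (forall i, i \in K -> 0 < w i ord0) ->
  \sum_(i in K) wb i ord0 / w i ord0 = #|K|%:R ->
  (geomean K w <= geomean K wb)%E ->
  forall i, i \in K -> wb i ord0 = w i ord0.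
Proof.
move=> w0 sumE /(geomean_le w0)[wb0 le_prod] i iK.
pose t j := wb j ord0 / w j ord0.
have K_gt0 : (0 < #|K|)%N by apply/card_gt0P; exists i.
have K_neq0 : #|K|%:R != 0 :> R by rewrite pnatr_eq0 -lt0n.
have t_ge0 : {in K, forall j, 0 <= t j}.
  by move=> j jK; rewrite divr_ge0 // ltW // ?w0 ?wb0.
have [le1 eq1] := leif_AGM t_ge0.
have pw0 : 0 < \prod_(j in K) w j ord0 by apply: prodr_gt0 => j /w0.
have prod_ge1 : 1 <= \prod_(j in K) t j.
  by rewrite big_split /= prodfV ler_pdivlMr // mul1r.
have t_const : [forall j in K, forall k in K, t j == t k].
  rewrite -eq1 eq_le le1 /= {1}/t sumE divff // expr1n //.
have ti : \sum_(j in K) t j = t i *+ #|K|.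
  rewrite (eq_bigr (fun=> t i)) ?sumr_const // => j jK.
  by move/forall_inP: t_const => /(_ j jK)/forall_inP/(_ i iK)/eqP.
have : t i * #|K|%:R = 1 * #|K|%:R by rewrite mulr_natr -ti sumE mul1r.
by move=> /(mulIf K_neq0) /divr1_eq.
Qed.

(** Since s_i z_i is a constant k, the form <s, -> is k times the sum weighted
    by the 1 / z_i, and only the indices in K contribute. *)
Lemma reciprocal_sum m (K : {set 'I_m}) (k : R) (s z a b : 'cV[R]_m) :
  k != 0 -> (forall i, s i ord0 * z i ord0 = k) ->
  (forall i, i \notin K -> a i ord0 = 0) ->
  (forall i, i \notin K -> b i ord0 = 0) ->
  inner s a = inner s b ->
  \sum_(i in K) a i ord0 / z i ord0 = \sum_(i in K) b i ord0 / z i ord0.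
Proof.
move=> k0 sz aK bK sab.
suff E (v : 'cV[R]_m) : (forall i, i \notin K -> v i ord0 = 0) ->
    \sum_(i in K) v i ord0 / z i ord0 = k^-1 * inner s v by rewrite !E // sab.
move=> vK; rewrite /inner [in RHS](bigID [in K]) /= [X in _ + X]big1 => [|i iK].
  rewrite addr0 mulr_sumr; apply: eq_bigr => i iK.
  have : s i ord0 * z i ord0 != 0 by rewrite sz.
  rewrite mulf_eq0 negb_or => /andP[s0 z0]; rewrite -(sz i).
  by field; rewrite s0 z0.
by rewrite vK // mulr0.
Qed.

Lemma reciprocal_sum_lim (T : Type) (F : set_system T) m (K : {set 'I_m})
    (f : T -> 'cV[R]_m) (w wb : 'cV[R]_m) : ProperFilter F ->
  f @ F --> w -> (forall i, i \in K -> 0 < w i ord0) ->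
  (\forall t \near F, \sum_(i in K) wb i ord0 / f t i ord0
    = \sum_(i in K) w i ord0 / f t i ord0) ->
  \sum_(i in K) wb i ord0 / w i ord0 = #|K|%:R.
Proof.
move=> FF fw w0 eqF.
have lim (v : 'cV[R]_m) : (fun t => \sum_(i in K) v i ord0 / f t i ord0) @ F
    --> \sum_(i in K) v i ord0 / w i ord0.
  apply: (@cvg_big R _ +%R 0 [in K] (@add_continuous R)) => i iK.
  apply: cvgM; first exact: cvg_cst.
  by apply: cvgV; [rewrite gt_eqF ?w0|exact: cvg_mx_entry].
rewrite (near_cvg_eq eqF (lim wb) (lim w)).
rewrite (eq_bigr (fun=> 1)) => [|i iK]; first by rewrite sumr_const.
by rewrite divff // gt_eqF ?w0.
Qed.

End Center.

(** * Relative interiors *)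

Section AffineHull.
Variable R : realType.

Lemma affine_hull_linear (E : normedModType R) (V : lmodType R) (A : set E)
    (f : E -> V) (b : V) (v : E) :
  (forall a w w', f (a *: w + w') = a *: f w + f w') ->
  (forall w, A w -> f w = b) -> affine_hull A v -> f v = b.
Proof.
move=> f_lin fA [k [t [w [wA sum_t ->]]]].
have f0 : f 0 = 0.
  have := f_lin 1 0 0; rewrite !scale1r addr0 => /eqP.
  by rewrite -subr_eq0 opprD addrA subrr add0r oppr_eq0 => /eqP.
have -> : f (\sum_(i < k) t i *: w i) = \sum_(i < k) t i *: f (w i).
  by elim/big_rec2: _ => // i a c _ <-; rewrite f_lin.
under eq_bigr => i _ do rewrite (fA _ (wA i)).
by rewrite -scaler_suml sum_t scale1r.
Qed.

Lemma near_pos (E : normedModType R) m (K : {set 'I_m}) (f : E -> 'cV[R]_m)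
    (v : E) : f @ v --> f v -> (forall i, i \in K -> 0 < f v i ord0) ->
  \forall w \near v, forall i, i \in K -> 0 < f w i ord0.
Proof.
move=> fv f0.
apply: (@filter_forall _ _ (fun i => [set w | i \in K -> 0 < f w i ord0])) => i.
have [/f0 fi|iK] := boolP (i \in K); last exact: nearW.
have f_gt0 : \forall w \near v, 0 < f w i ord0.
  exact: (cvgr_gt _ (cvg_mx_entry (i := i) (j := ord0) fv) _ fi).
by near=> w => _; near: w.
Unshelve. all: by end_near. Qed.

End AffineHull.

(** * The limit of the central path *)

Section Path.
Variables (R : realType) (n p q : nat).
Hypothesis p_gt0 : (0 < p)%N.
Variables (Phi : 'M[R]_(q, n)) (y : 'cV[R]_q) (D : 'M[R]_(n, p)) (lambda : R).

Local Notation Q := (Qmx Phi).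
Local Notation c := (cvec Phi y).
Local Notation It := (Itilde R p).
Local Notation e := (evec R p).
Local Notation SP := (sol_primal Phi y D lambda).
Local Notation SD := (sol_dual Phi y D lambda).
Local Notation kkt := (kkt Phi y D lambda).
Local Notation central := (central Phi y D lambda).
Local Notation Ib := (Ibar Phi y D lambda).
Local Notation Jb := (Jbar Phi y D lambda).

Let natp_gt0 : 0 < (2 * p)%:R :> R.
Proof. by rewrite ltr0n muln_gt0. Qed.

(** All primal solutions have the same Phi x and the same <e, z>, and these two
    quantities determine <s, z> for a dual feasible slack. *)
Lemma primal_slack_invariant x1 z1 s1 u1 x2 z2 x s u :
  kkt x1 z1 s1 u1 -> SP (x2, z2) -> dual_feasible Phi y D lambda x s u ->
  inner s z1 = inner s z2.
Proof.
move=> K1 S2 [_ Du sE]; have K2 := kkt_exchange_primal K1 S2.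
have [_ Ex _] := (sol_primalP x2 z2 K1).1 S2.
have [[_ P1] [_ Du1 s1E] sz1] := K1; have [[_ P2] _ sz2] := K2.
have := slack_pairing Du1 s1E P1; have := slack_pairing Du1 s1E P2.
rewrite (slack_pairing Du sE P1) (slack_pairing Du sE P2) sz1 sz2.
rewrite !Qmx_gradient Ex; lra.
Qed.

(** All dual solutions have the same Phi x, hence the same D u, which determines
    <s, z> for a primal feasible (x, z). *)
Lemma dual_slack_invariant x1 z1 s1 u1 x2 s2 u2 x z :
  kkt x1 z1 s1 u1 -> SD (x2, s2, u2) -> primal_feasible D x z ->
  inner z s1 = inner z s2.
Proof.
move=> K1 S2 [_ P].
have [[_ Du2 s2E] Ex _] := (sol_dualP x2 s2 u2 K1).1 S2.
have [_ [_ Du1 s1E] _] := K1.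
rewrite !(innerC z) (slack_pairing Du1 s1E P) (slack_pairing Du2 s2E P).
by rewrite !Qmx_gradient Ex.
Qed.

Lemma slackE mu (z : 'cV[R]_(p + p)) i : (forall j, 0 < z j ord0) ->
  slack mu z i ord0 = mu / (2 * p)%:R / z i ord0.
Proof.
move=> z_gt0; rewrite /slack.
have Zunit : diag_mx z^T \in unitmx.
  rewrite unitmxE det_diag unitfE; apply/prodf_neq0 => j _.
  by rewrite mxE gt_eqF.
have -> : e = diag_mx z^T *m (\col_j (z j ord0)^-1).
  apply/colP => j; rewrite mul_diag_mx !mxE.
  by rewrite divff // gt_eqF.
by rewrite mulKmx // !mxE.
Qed.

(** The barrier objective is finite at the Slater point (0, mu e), hence at its
    minimizer. *)
Lemma barrier_minimizer_feasible mu x z : 0 < mu ->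
  minimizer [set: 'cV[R]_n * 'cV[R]_(p + p)]
    (fun w => F_barrier Phi y D lambda mu w.1 w.2) (x, z) ->
  primal_feasible D x z /\ forall i, 0 < z i ord0.
Proof.
move=> mu_gt0 [_ /(_ (0, mu *: e) I)] /=.
have Fe_lty : (F_barrier Phi y D lambda mu 0%R (mu *: e)%R < +oo)%E.
  rewrite /F_barrier /f_primal mulmx0 add0r /Itilde /evec -scalemxAr.
  rewrite -(@col_mx_const R p p 1) mul_row_col mul1mx mulNmx mul1mx subrr.
  rewrite scaler0 eqxx /xi ifT ?ltry //.
  apply/forallP => i; rewrite scalerA mulVf ?gt_eqF // scale1r.
  by rewrite col_mx_const mxE.
move=> /le_lt_trans/(_ Fe_lty); rewrite /F_barrier /xi.
case: ifPn => [/forallP z_gt0|_]; last first.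
  by rewrite gt0_muley ?lte_fin // /f_primal; case: ifP.
rewrite /f_primal; case: eqP => // Pz _.
have zpos i : 0 < z i ord0.
  by have := z_gt0 i; rewrite mxE pmulr_rgt0 // invr_gt0.
by split=> //; split=> // i; exact: ltW.
Qed.

Lemma barrier_path_central mu x z s u : 0 < mu ->
  minimizer [set: 'cV[R]_n * 'cV[R]_(p + p)]
    (fun w => F_barrier Phi y D lambda mu w.1 w.2) (x, z) ->
  s = slack mu z ->
  Q *m x - c - D *m u = 0 /\ lambda *: e - s - It^T *m u = 0 ->
  central mu x z s u.
Proof.
move=> mu_gt0 /(barrier_minimizer_feasible mu_gt0)[Pxz z_gt0] sE [Du su].
have s_gt0 i : 0 < s i ord0 by rewrite sE slackE // !divr_gt0.
split=> //; last by move=> i; rewrite sE slackE // divfK // gt_eqF.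
split=> [i||]; first exact: ltW.
- apply/eqP; rewrite -oppr_eq0 -Du !opprD opprK.
  by apply/eqP; rewrite addrC addrA addrAC.
- by move/eqP: su; rewrite addrAC subr_eq0 => /eqP.
Qed.

(** The two halves of s are lambda - u and lambda + u, both nonnegative, and
    their sum is 2 lambda. *)
Lemma dual_bound x s u i :
  dual_feasible Phi y D lambda x s u -> s i ord0 <= 2 * lambda.
Proof.
move=> [s_ge0 _ sE].
have uE : It^T *m u = col_mx u (- u).
  rewrite /Itilde tr_row_mx mul_col_mx trmx1 mul1mx.
  by rewrite linearN /= trmx1 mulNmx mul1mx.
have su j : s (lshift p j) ord0 = lambda - u j ord0.
  by rewrite sE uE !mxE (unsplitK (inl j)) mulr1.
have sd j : s (rshift p j) ord0 = lambda + u j ord0.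
  by rewrite sE uE !mxE (unsplitK (inr j)) mulr1 mxE opprK.
case: (split_ordP i) => j ->.
- by rewrite su; have := s_ge0 (rshift p j); rewrite sd; lra.
- by rewrite sd; have := s_ge0 (lshift p j); rewrite su; lra.
Qed.

Lemma Itilde_left_inverse : row_mx 1%:M 0 *m It^T = 1%:M :> 'M[R]_p.
Proof.
by rewrite /Itilde tr_row_mx mul_row_col trmx1 mul1mx mul0mx addr0.
Qed.

(** The kernel condition makes x a linear function of (D^T x, Phi x), so x(mu)
    inherits its convergence from z(mu) and Phi x(mu). *)
Lemma stacked_left_inverse :
  [set v : 'cV[R]_n | D^T *m v = 0] `&` [set v : 'cV[R]_n | Phi *m v = 0]
    = [set 0] ->
  exists L : 'M[R]_(n, p + q), L *m col_mx D^T Phi = 1%:M.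
Proof.
move=> kerDPhi.
have /row_freeP[B MB] : row_free (col_mx D^T Phi)^T.
  apply: inj_row_free => v /(congr1 trmx).
  rewrite trmx_mul trmxK trmx0 mul_col_mx -col_mx0 => /eq_col_mx[Dv Phiv].
  have : ([set 0] : set 'cV[R]_n) v^T by rewrite -kerDPhi.
  by move=> /= /(congr1 trmx); rewrite trmxK trmx0.
by exists B^T; rewrite -[col_mx _ _]trmxK -trmx_mul MB trmx1.
Qed.

Section UltraLimit.
Hypothesis lambda_gt0 : 0 < lambda.
Hypothesis kerDPhi :
  [set v : 'cV[R]_n | D^T *m v = 0] `&` [set v : 'cV[R]_n | Phi *m v = 0]
    = [set 0].
Variables (x : R -> 'cV[R]_n) (z s : R -> 'cV[R]_(p + p)) (u : R -> 'cV[R]_p).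
Hypothesis path_central : forall mu, 0 < mu ->
  central mu (x mu) (z mu) (s mu) (u mu).
Variables (xbar : 'cV[R]_n) (zbar sbar : 'cV[R]_(p + p)) (ubar : 'cV[R]_p).
Hypothesis xzbar_center : primal_center Phi y D lambda xbar zbar.
Hypothesis subar_center : dual_center Phi y D lambda xbar sbar ubar.

Let K : kkt xbar zbar sbar ubar.
Proof. by apply: center_dom_kkt; [case: xzbar_center|case: subar_center]. Qed.

Variable U : set_system R.
Hypothesis U_ultra : UltraFilter U.
Hypothesis U_right : (0 : R)^'+ `<=` U.

Let U_pos : \forall mu \near U, 0 < mu.
Proof. by apply: U_right; exact: nbhs_right_gt. Qed.

Let U_le1 : \forall mu \near U, mu <= 1.
Proof. by apply: U_right; exact: nbhs_right_le. Qed.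

Let U_cvg0 : id @ U --> (0 : R).
Proof.
move=> A A0; apply: U_right; exact: cvg_within A0.
Qed.

Lemma path_subconverges : exists xh zh sh uh,
  [/\ x @ U --> (xh : 'cV[R]_n), z @ U --> (zh : 'cV[R]_(p + p)),
      s @ U --> (sh : 'cV[R]_(p + p)) & u @ U --> (uh : 'cV[R]_p)] /\
  kkt xh zh sh uh.
Proof.
have [zh z_zh] : exists zh : 'cV[R]_(p + p), z @ U --> zh.
  pose b := (lambda * inner e zbar + 1
    + 2^-1 * inner (Phi *m xbar - y) (Phi *m xbar - y)) / lambda.
  apply: (@ultra_bounded_cvg _ _ _ _ _ b) => //.
  near=> mu => i; have mu_gt0 : 0 < mu by near: mu.
  have mu_le1 : mu <= 1 by near: mu.
  have C := path_central mu_gt0; have [P _ z_gt0 _ _] := C.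
  rewrite gtr0_norm // ler_pdivlMr // mulrC.
  have := central_primal_bound p_gt0 C K.
  have e_ge0 : orthant R (p + p) e by move=> j; rewrite mxE.
  have := inner_ge_term i e_ge0 P.1; rewrite [e i ord0]mxE mul1r.
  rewrite -(ler_pM2l lambda_gt0); lra.
have [sh s_sh] : exists sh : 'cV[R]_(p + p), s @ U --> sh.
  apply: (@ultra_bounded_cvg _ _ _ _ _ (2 * lambda)) => //.
  near=> mu => i; have mu_gt0 : 0 < mu by near: mu.
  have [_ Dx _ s_gt0 _] := path_central mu_gt0.
  by rewrite gtr0_norm //; exact: dual_bound Dx.
(* Any bound on the entries suffices here; |Phi (x(mu) - xbar)|^2 <= mu <= 1. *)
have [w Phix_w] : exists w : 'cV[R]_q,
    (fun mu => Phi *m (x mu - xbar)) @ U --> w.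
  apply: (@ultra_bounded_cvg _ _ _ _ _ 1) => //.
  near=> mu => i; have mu_gt0 : 0 < mu by near: mu.
  have mu_le1 : mu <= 1 by near: mu.
  have := central_image_bound p_gt0 (path_central mu_gt0) K.
  set v := Phi *m _ => v_le.
  rewrite -(@ler_pXn2r _ 2) ?nnegrE // expr1n -normrX ger0_norm ?sqr_ge0 //.
  apply: le_trans (le_trans v_le mu_le1).
  rewrite /inner (bigD1 i) //= expr2 lerDl.
  by apply: sumr_ge0 => j _; rewrite -expr2 sqr_ge0.
have [L LE] := stacked_left_inverse kerDPhi.
pose xh := L *m col_mx (- (It *m zh)) (w + Phi *m xbar).
have x_xh : x @ U --> xh.
  have cvg_col : (fun mu => col_mx (- (It *m z mu))
      (Phi *m (x mu - xbar) + Phi *m xbar)) @ U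
      --> col_mx (- (It *m zh)) (w + Phi *m xbar).
    apply: cvg_mx => i j; case: (split_ordP i) => k ->.
    - rewrite col_mxEu; under eq_fun do rewrite col_mxEu.
      by apply: cvg_mx_entry; apply: cvgN; exact: cvg_mulmx.
    - rewrite col_mxEd; under eq_fun do rewrite col_mxEd.
      by apply: cvg_mx_entry; apply: cvgD => //; exact: cvg_cst.
  apply: cvg_trans (cvg_mulmx (A := L) cvg_col); apply: near_eq_cvg.
  near=> mu; have mu_gt0 : 0 < mu by near: mu.
  have [[_ /eqP Pz] _ _ _ _] := path_central mu_gt0.
  move: Pz; rewrite addr_eq0 => /eqP <-.
  by rewrite mulmxBr subrK -mul_col_mx mulmxA LE mul1mx.
pose L' : 'M[R]_(p, p + p) := row_mx 1%:M 0.
have uE mu : 0 < mu -> L' *m (lambda *: e - s mu) = u mu.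
  move=> mu_gt0; have [_ [_ _ ->] _ _ _] := path_central mu_gt0.
  by rewrite opprB addrC subrK mulmxA Itilde_left_inverse mul1mx.
have u_uh : u @ U --> L' *m (lambda *: e - sh).
  have s_sub : (fun mu => lambda *: e - s mu) @ U --> lambda *: e - sh.
    by apply: cvgB => //; exact: cvg_cst.
  apply: cvg_trans (cvg_mulmx (A := L') s_sub); apply: near_eq_cvg.
  by near=> mu; apply: uE; near: mu.
exists xh, zh, sh, (L' *m (lambda *: e - sh)); split=> //.
have ge0_lim (m : nat) (f : R -> 'cV[R]_m) (fh : 'cV[R]_m) : f @ U --> fh ->
    (forall mu, 0 < mu -> forall i, 0 < f mu i ord0) -> orthant R m fh.
  move=> f_fh f_gt0 i; have fi : f mu i ord0 @[mu --> U] --> fh i ord0.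
    exact: cvg_mx_entry.
  have f_ge0 : \forall mu \near U, 0 <= f mu i ord0.
    by near=> mu; apply/ltW/f_gt0; near: mu.
  exact: (closed_cvg (fun r : R => 0 <= r) (@closed_ge R 0) f_ge0 _ fi).
split; first split.
- by apply: ge0_lim z_zh _ => mu mu_gt0; case: (path_central mu_gt0).
- apply: (@near_cvg_eq _ _ U _ _ (fun mu => D^T *m x mu + It *m z mu)
    (fun=> 0)).
  + by near=> mu; have /path_central[[]] : 0 < mu by near: mu.
  + by apply: cvgD; exact: cvg_mulmx.
  + exact: cvg_cst.
- split.
  + by apply: ge0_lim s_sh _ => mu mu_gt0; case: (path_central mu_gt0).
  + apply: (@near_cvg_eq _ _ U _ _ (fun mu => D *m u mu + c - Q *m x mu)
      (fun=> 0)).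
    * by near=> mu; have /path_central[_ []] : 0 < mu by near: mu.
    * apply: cvgB; last exact: cvg_mulmx.
      by apply: cvgD; [exact: cvg_mulmx|exact: cvg_cst].
    * exact: cvg_cst.
  + apply: (@near_cvg_eq _ _ U _ _ s
      (fun mu => lambda *: e - It^T *m u mu)) => //.
    * by near=> mu; have /path_central[_ []] : 0 < mu by near: mu.
    * by apply: cvgB; [exact: cvg_cst|exact: cvg_mulmx].
- apply: (@near_cvg_eq _ _ U _ _ (fun mu => inner (s mu) (z mu)) id
    _ _ _ _ U_cvg0).
  + near=> mu; have mu_gt0 : 0 < mu by near: mu.
    exact: (central_gap p_gt0 (path_central mu_gt0)).
  + apply: (@cvg_big R _ +%R 0 xpredT (@add_continuous R)) => i _.
    by apply: cvgM; exact: cvg_mx_entry.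
Unshelve. all: by end_near. Qed.

(** Identifies the limit along U: the optimality of the centers is used only
    against the limit point itself, where [primal_slack_invariant] and
    [dual_slack_invariant] supply the mean of the ratios. *)
Lemma path_limit :
  [/\ x @ U --> xbar, z @ U --> zbar, s @ U --> sbar & u @ U --> ubar] /\
  (forall i, i \in Ib -> 0 < zbar i ord0) /\
  (forall i, i \in Jb -> 0 < sbar i ord0).
Proof.
have [xh [zh [sh [uh [[x_xh z_zh s_sh u_uh] Kh]]]]] := path_subconverges.
have [Sxz Sxs] := kkt_sol Kh; have [Sxzbar Sxsbar] := kkt_sol K.
have [Ph Dh _] := Kh; have [Pbar Dbar _] := K.
have [sh_ge0 _ shE] := Dh; have [sbar_ge0 _ sbarE] := Dbar.
have lim_gt0 (f : R -> 'cV[R]_(p + p)) (fh : 'cV[R]_(p + p)) (w : R) i :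
    f @ U --> fh -> 0 < w ->
    (forall mu, 0 < mu -> w <= (2 * p)%:R * f mu i ord0) -> 0 < fh i ord0.
  move=> f_fh w_gt0 f_ge.
  have fi : f mu i ord0 @[mu --> U] --> fh i ord0 by exact: cvg_mx_entry.
  apply: lt_le_trans (divr_gt0 w_gt0 natp_gt0) _.
  apply: (closed_cvg (fun r : R => _ <= r) (@closed_ge R _) _ _ fi).
  by near=> mu; rewrite ler_pdivrMr // mulrC f_ge //; near: mu.
have zh_gt0 i : i \in Ib -> 0 < zh i ord0.
  rewrite inE => /asboolP[x' [z' [S' z'_gt0]]].
  apply: lim_gt0 z_zh z'_gt0 _ => mu mu_gt0.
  have K' := kkt_exchange_primal K S'.
  exact: (central_primal_ge p_gt0 (path_central mu_gt0) K').
have sh_gt0 i : i \in Jb -> 0 < sh i ord0.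
  rewrite inE => /asboolP[x' [s' [u' [S' s'_gt0]]]].
  apply: lim_gt0 s_sh s'_gt0 _ => mu mu_gt0.
  have K' := kkt_exchange_dual K S'.
  exact: (central_dual_ge p_gt0 (path_central mu_gt0) K').
have sum_z : \sum_(i in Ib) zbar i ord0 / zh i ord0 = #|Ib|%:R.
  apply: (reciprocal_sum_lim _ z_zh zh_gt0).
  near=> mu; have mu_gt0 : 0 < mu by near: mu.
  have [_ Dmu _ _ sz] := path_central mu_gt0.
  apply: (reciprocal_sum _ sz); first by rewrite mulf_neq0 ?invr_neq0 ?gt_eqF.
  - by move=> i iI; exact: (sol_primal_off_Ibar Pbar.1 Sxzbar iI).
  - by move=> i iI; exact: (sol_primal_off_Ibar Ph.1 Sxz iI).
  - exact: (primal_slack_invariant K Sxz Dmu).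
have sum_s : \sum_(i in Jb) sbar i ord0 / sh i ord0 = #|Jb|%:R.
  apply: (reciprocal_sum_lim _ s_sh sh_gt0).
  near=> mu; have mu_gt0 : 0 < mu by near: mu.
  have [Pmu _ _ _ sz] := path_central mu_gt0.
  have zs i : z mu i ord0 * s mu i ord0 = mu / (2 * p)%:R by rewrite mulrC sz.
  apply: (reciprocal_sum _ zs); first by rewrite mulf_neq0 ?invr_neq0 ?gt_eqF.
  - by move=> i iJ; exact: (sol_dual_off_Jbar sbar_ge0 Sxsbar iJ).
  - by move=> i iJ; exact: (sol_dual_off_Jbar sh_ge0 Sxs iJ).
  - exact: (dual_slack_invariant K Sxs Pmu).
have [_ Phi_xh _] := (sol_primalP xh zh K).1 Sxz.
have zE : zbar = zh.
  apply/colP => i; have [iI|iI] := boolP (i \in Ib).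
    apply: (geomean_unique zh_gt0 sum_z _ iI).
    exact: xzbar_center.2 _ (kkt_primal_center_dom Kh).
  rewrite (sol_primal_off_Ibar Pbar.1 Sxzbar iI).
  by rewrite (sol_primal_off_Ibar Ph.1 Sxz iI).
have sE : sbar = sh.
  apply/colP => i; have [iJ|iJ] := boolP (i \in Jb).
    apply: (geomean_unique sh_gt0 sum_s _ iJ).
    exact: subar_center.2 _ (kkt_dual_center_dom Kh (esym Phi_xh)).
  rewrite (sol_dual_off_Jbar sbar_ge0 Sxsbar iJ).
  by rewrite (sol_dual_off_Jbar sh_ge0 Sxs iJ).
have xE : xbar = xh.
  apply/esym/eqP; rewrite -subr_eq0; apply/eqP.
  rewrite -[_ - _ = 0]/([set 0] (xh - xbar)) -kerDPhi; split=> /=.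
    move/eqP: Ph.2; move/eqP: Pbar.2; rewrite zE !addr_eq0.
    by move=> /eqP Dxbar /eqP Dxh; rewrite mulmxBr Dxbar Dxh subrr.
  by rewrite mulmxBr Phi_xh subrr.
have uE : ubar = uh.
  have It_u : It^T *m ubar = It^T *m uh.
    have /eqP := sbarE; rewrite sE {1}shE (can_eq (subKr _)).
    by move=> /eqP ->.
  by rewrite -[ubar]mul1mx -[uh]mul1mx -Itilde_left_inverse -!mulmxA It_u.
by rewrite xE zE sE uE.
Unshelve. all: by end_near. Qed.

End UltraLimit.

(** On the affine hull of the solutions only the inequalities z_i >= 0 with i in
    I remain to be checked, and they are strict at z0, hence open. *)
Lemma primal_relative_interior x0 z0 s0 u0 : kkt x0 z0 s0 u0 ->
  (forall i, i \in Ib -> 0 < z0 i ord0) -> relative_interior SP (x0, z0).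
Proof.
move=> K z0_gt0; have [S0 D0] := kkt_sol K.
split=> //; rewrite /within /=.
pose E : normedModType R := ('cV[R]_n * 'cV[R]_(p + p))%type.
have z_pos : \forall w \near ((x0, z0) : E),
    forall i, i \in Ib -> 0 < (w : E).2 i ord0.
  by apply: near_pos => //; exact: cvg_snd.
apply: filterS z_pos => -[x z] /= z_gt0 hull.
have feas : D^T *m x + It *m z = 0.
  apply: (affine_hull_linear (f := fun w : E => D^T *m w.1 + It *m w.2)
    _ _ hull) => [a w w'|[x' z'] S'] /=.
    by rewrite !mulmxDr -!scalemxAr scalerDr addrACA.
  by have [[]] := kkt_exchange_primal K S'.
have Phix : Phi *m x = Phi *m x0.
  apply: (affine_hull_linear (f := fun w : E => Phi *m w.1)
    _ _ hull) => [a w w'|[x' z'] S'] /=.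
    by rewrite mulmxDr -scalemxAr.
  by have [] := (sol_primalP x' z' K).1 S'.
have z_off i : i \notin Ib -> z i ord0 = 0.
  move=> iI.
  apply: (affine_hull_linear (f := fun w : E => w.2 i ord0 : R^o)
    _ _ hull) => [a w w'|[x' z'] S'] /=; first by rewrite !mxE.
  have [[z'_ge0 _] _ _] := kkt_exchange_primal K S'.
  exact: (sol_primal_off_Ibar z'_ge0 S').
apply/(sol_primalP _ _ K); split=> //.
  split=> // i; have [/z_gt0/ltW //|/z_off ->] := boolP (i \in Ib).
  by [].
apply: big1 => i _; have [iI|/z_off ->] := boolP (i \in Ib); last exact: mulr0.
have /eqP := kkt_compl i K; rewrite mulf_eq0 orbC gt_eqF ?z0_gt0 //= => /eqP ->.
exact: mul0r.
Qed.

Lemma dual_relative_interior x0 z0 s0 u0 : kkt x0 z0 s0 u0 ->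
  (forall i, i \in Jb -> 0 < s0 i ord0) -> relative_interior SD (x0, s0, u0).
Proof.
move=> K s0_gt0; have [P0 S0] := kkt_sol K.
split=> //; rewrite /within /=.
pose E : normedModType R := ('cV[R]_n * 'cV[R]_(p + p) * 'cV[R]_p)%type.
have s_pos : \forall w \near ((x0, s0, u0) : E),
    forall i, i \in Jb -> 0 < (w : E).1.2 i ord0.
  apply: near_pos => //=; apply: (@cvg_comp _ _ _ fst snd _ (nbhs (x0, s0))).
    exact: cvg_fst.
  exact: cvg_snd.
apply: filterS s_pos => -[[x s] u] /= s_gt0 hull.
have Du : D *m u - Q *m x = - c.
  apply: (affine_hull_linear (f := fun w : E => D *m w.2 - Q *m w.1.1)
    _ _ hull) => [a w w'|[[x' s'] u'] S'] /=.
    by rewrite !mulmxDr -!scalemxAr scalerBr opprD addrACA.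
  have [[_ /eqP + _] _ _] := (sol_dualP x' s' u' K).1 S'.
  by rewrite addrAC addr_eq0 => /eqP.
have sE : s + It^T *m u = lambda *: e.
  apply: (affine_hull_linear (f := fun w : E => w.1.2 + It^T *m w.2)
    _ _ hull) => [a w w'|[[x' s'] u'] S'] /=.
    by rewrite !mulmxDr -!scalemxAr scalerDr addrACA.
  by have [[_ _ ->] _ _] := (sol_dualP x' s' u' K).1 S'; rewrite subrK.
have Phix : Phi *m x = Phi *m x0.
  apply: (affine_hull_linear (f := fun w : E => Phi *m w.1.1)
    _ _ hull) => [a w w'|[[x' s'] u'] S'] /=.
    by rewrite mulmxDr -scalemxAr.
  by have [] := (sol_dualP x' s' u' K).1 S'.
have s_off i : i \notin Jb -> s i ord0 = 0.
  move=> iJ.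
  apply: (affine_hull_linear (f := fun w : E => w.1.2 i ord0 : R^o)
    _ _ hull) => [a w w'|[[x' s'] u'] S'] /=; first by rewrite !mxE.
  have [[s'_ge0 _ _] _ _] := (sol_dualP x' s' u' K).1 S'.
  exact: (sol_dual_off_Jbar s'_ge0 S').
apply/(sol_dualP _ _ _ K); split=> //.
  split=> [i||]; last by rewrite -sE addrK.
    by have [/s_gt0/ltW //|/s_off ->] := boolP (i \in Jb).
  by rewrite addrAC Du addNr.
apply: big1 => i _; have [iJ|/s_off ->] := boolP (i \in Jb); last exact: mul0r.
have /eqP := kkt_compl i K; rewrite mulf_eq0 gt_eqF ?s0_gt0 //= => /eqP ->.
exact: mulr0.
Qed.

End Path.

Theorem theorem5p6 (R : realType) (n p q : nat)
  (n_gt0 : (0 < n)%N) (p_gt0 : (0 < p)%N) (q_gt0 : (0 < q)%N)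
  (Phi : 'M[R]_(q, n)) (y : 'cV[R]_q) (D : 'M[R]_(n, p)) (lambda : R)
  (lambda_gt0 : 0 < lambda)
  (kerDPhi : [set v : 'cV[R]_n | D^T *m v = 0] `&` [set v : 'cV[R]_n | Phi *m v = 0]
             = [set 0])
  (x : R -> 'cV[R]_n) (z s : R -> 'cV[R]_(p + p)) (u : R -> 'cV[R]_p)
  (xz_min : forall mu : R, 0 < mu ->
     minimizer [set: 'cV[R]_n * 'cV[R]_(p + p)]
       (fun w => F_barrier Phi y D lambda mu w.1 w.2) (x mu, z mu))
  (s_def : forall mu : R, 0 < mu -> s mu = slack mu (z mu))
  (u_def : forall mu : R, 0 < mu ->
     Qmx Phi *m x mu - cvec Phi y - D *m u mu = 0 /\
     lambda *: evec R p - s mu - (Itilde R p)^T *m u mu = 0)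
  (xbar : 'cV[R]_n) (zbar sbar : 'cV[R]_(p + p)) (ubar : 'cV[R]_p)
  (xzbar_center : primal_center Phi y D lambda xbar zbar)
  (subar_center : dual_center Phi y D lambda xbar sbar ubar) :
  [/\ (x mu, z mu, s mu, u mu) @[mu --> 0^'+] --> (xbar, zbar, sbar, ubar),
      relative_interior (sol_primal Phi y D lambda) (xbar, zbar)
    & relative_interior (sol_dual Phi y D lambda) (xbar, sbar, ubar)].
Proof.
have path_central mu : 0 < mu ->
    central Phi y D lambda mu (x mu) (z mu) (s mu) (u mu).
  move=> mu_gt0; apply: (barrier_path_central p_gt0 mu_gt0 (xz_min mu mu_gt0)).
  - exact: s_def.
  - exact: u_def.
have lim := path_limit p_gt0 lambda_gt0 kerDPhi path_central xzbar_center
  subar_center.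
have K : kkt Phi y D lambda xbar zbar sbar ubar.
  by apply: center_dom_kkt; [case: xzbar_center|case: subar_center].
have [U [U_ultra U_right]] := ultraFilterLemma (at_right_proper_filter (0 : R)).
have [_ [z_gt0 s_gt0]] := lim U U_ultra U_right.
split.
- pose E : topologicalType :=
    ('cV[R]_n * 'cV[R]_(p + p) * 'cV[R]_(p + p) * 'cV[R]_p)%type.
  apply: (@cvg_ultra R E _ (fun mu => (x mu, z mu, s mu, u mu))
    (xbar, zbar, sbar, ubar) (at_right_proper_filter (0 : R))).
  move=> G G_ultra G_right.
  have [[x_cvg z_cvg s_cvg u_cvg] _] := lim G G_ultra G_right.
  exact: (cvg_pair (cvg_pair (cvg_pair x_cvg z_cvg) s_cvg) u_cvg).
- exact: (primal_relative_interior K).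
- exact: (dual_relative_interior K).
Qed.
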